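(* Let $A,B,C$ be complex vector spaces of the same finite dimension $m$, and let $T\in A\otimes B\otimes C$ be a concise tensor with flattening $T_A:A^*\to B\otimes C$. Suppose that $T$ is of degenerate geometric rank and that the rank $1$ locus of $T$ achieves $\mathrm{GR}(T)$. Then at least one of the following holds: (a) $\mathbb{P}T_A(A^* )$ contains a positive-dimensional linear subspace of $\mathbb{P}(B\otimes C)$ that is contained in the Segre variety $\mathrm{Seg}(\mathbb{P}B\times\mathbb{P}C)$. (b) There exists a quotient $A\twoheadrightarrow A'$ such that $T_A((A')^* )$ (where $(A')^*\subseteq A^*$) is equivalent, up to the action of $\mathrm{GL}(B)\times\mathrm{GL}(C)$, to the space of symmetric $2\times2$ matrices. Moreover, the rank $2$ locus of $T$ also achieves $\mathrm{GR}(T)$.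
   Context: Everything is over $\mathbb{C}$. For $T\in A\otimes B\otimes C$ the flattenings are the induced linear maps $T_A:A^*\to B\otimes C$, $T_B:B^*\to A\otimes C$, $T_C:C^*\to A\otimes B$; $T$ is concise if all three are injective. Elements of $B\otimes C=\mathrm{Hom}(B^*,C)$ are regarded as matrices, and $\mathrm{Seg}(\mathbb{P}B\times\mathbb{P}C)\subseteq\mathbb{P}(B\otimes C)$ is the Segre variety of classes of rank $1$ matrices. The rank $r$ locus of $T$ is $Y^r_T:=\{[\alpha]\in\mathbb{P}A^*\mid \mathrm{rank}\,T_A(\alpha)\le r\}\subseteq\mathbb{P}A^*$. The geometric rank of $T$ is $$\mathrm{GR}(T):=\min_{r\ge0}\bigl(\mathrm{codim}_{\mathbb{P}A^*}(Y^r_T)+r\bigr),$$ with the convention $\dim\emptyset=-1$ (so the empty set has codimension $\dim A$ in $\mathbb{P}A^*$). One says that the rank $r$ locus $Y^r_T$ (or the integer $r$) achieves $\mathrm{GR}(T)$ if $\mathrm{GR}(T)=\mathrm{codim}_{\mathbb{P}A^*}(Y^r_T)+r$. The tensor $T$ has degenerate geometric rank if $\mathrm{GR}(T)<\min\{\dim A,\dim B,\dim C\}$. A subspace of $B\otimes C$ is equivalent to the space of symmetric $2\times 2$ matrices if, for some linearly independent $b_1,b_2\in B$ and linearly independent $c_1,c_2\in C$, it equals the span of $b_1\otimes c_1,\ b_1\otimes c_2+b_2\otimes c_1,\ b_2\otimes c_2$. *)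

(* Defs.v *)
(* MathComp + MathComp-Analysis; only the low-level analysis files are loaded,
   because [normedtype] and [mpoly] have clashing notations. *)
From HB Require Import structures.
From mathcomp Require Import all_boot all_order all_algebra.
From mathcomp Require Import complex.
From mathcomp Require Import mpoly.
From mathcomp Require Import classical_sets reals constructive_ereal ereal.

Set Implicit Arguments.
Unset Strict Implicit.
Unset Printing Implicit Defensive.

Import Order.TTheory GRing.Theory Num.Theory.
Local Open Scope classical_set_scope.
Local Open Scope ring_scope.

(* A subset of P^(n-1) is represented by the set of its nonzero representatives
   in 'rV_n.  The sets in the image of [proj_zeros] are invariant under scaling,
   so inclusion and equality of these representatives are inclusion and equality
   of the projective sets. *)
Definition proj_zeros (R : realType) (n : nat) (S : set {mpoly R[i][n]}) :
    set 'rV[R[i]]_n :=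
  [set v : 'rV[R[i]]_n | v != 0 /\ forall p, S p -> p.@[fun i => v 0 i] = 0].

Definition proj_closed (R : realType) (n : nat) (Y : set 'rV[R[i]]_n) : Prop :=
  exists2 S : set {mpoly R[i][n]},
    forall p, S p -> exists d : nat, p \is d.-homog & Y = proj_zeros S.

Definition proj_irreducible_closed (R : realType) (n : nat)
    (Y : set 'rV[R[i]]_n) : Prop :=
  [/\ proj_closed Y, Y !=set0 &
      forall Z1 Z2 : set 'rV[R[i]]_n, proj_closed Z1 -> proj_closed Z2 ->
        Y `<=` Z1 `|` Z2 -> Y `<=` Z1 \/ Y `<=` Z2].

(* X 0 < X 1 < ... < X (k - 1): a strict chain of k irreducible closed subsets
   of Y; the values X i for i >= k are irrelevant. *)
Definition irreducible_chain (R : realType) (n : nat) (Y : set 'rV[R[i]]_n)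
    (k : nat) (X : nat -> set 'rV[R[i]]_n) : Prop :=
  (forall i, (i < k)%N -> proj_irreducible_closed (X i) /\ X i `<=` Y) /\
  (forall i, (i.+1 < k)%N -> X i `<` X i.+1).

(* Krull dimension of a Zariski closed Y, that is, the supremum of the lengths
   of the strict chains of irreducible closed subsets.  A chain of k members has
   length k - 1, and the chain with no member gives dim set0 = -1.  The supremum
   is taken in the extended reals so that it is total. *)
Definition proj_dim (R : realType) (n : nat) (Y : set 'rV[R[i]]_n) : \bar R :=
  ereal_sup [set ((k%:R - 1)%:E : \bar R) |
              k in [set k : nat | exists X, irreducible_chain Y k X]].

(* The dimension of P^(n-1) is n - 1, with value -1 for n = 0. *)
Definition proj_codim (R : realType) (n : nat) (Y : set 'rV[R[i]]_n) : \bar R :=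
  ((n%:R - 1)%:E - proj_dim Y)%E.

(* Tensors in A (x) B (x) C in coordinates, for A, B, C of dimensions a, b, c;
   dual spaces carry the dual bases, so that A^* is again 'rV_a. *)
Definition tensor (R : realType) (a b c : nat) : Type :=
  'I_a -> 'I_b -> 'I_c -> R[i].

Definition flatA (R : realType) (a b c : nat) (T : tensor R a b c)
    (alpha : 'rV[R[i]]_a) : 'M[R[i]]_(b, c) :=
  \matrix_(j, k) \sum_i alpha 0 i * T i j k.

Definition flatB (R : realType) (a b c : nat) (T : tensor R a b c)
    (beta : 'rV[R[i]]_b) : 'M[R[i]]_(a, c) :=
  \matrix_(i, k) \sum_j beta 0 j * T i j k.

Definition flatC (R : realType) (a b c : nat) (T : tensor R a b c)
    (gamma : 'rV[R[i]]_c) : 'M[R[i]]_(a, b) :=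
  \matrix_(i, j) \sum_k gamma 0 k * T i j k.

Definition concise (R : realType) (a b c : nat) (T : tensor R a b c) : Prop :=
  [/\ injective (flatA T), injective (flatB T) & injective (flatC T)].

Definition rank_locus (R : realType) (a b c : nat) (T : tensor R a b c)
    (r : nat) : set 'rV[R[i]]_a :=
  [set alpha | alpha != 0 /\ (\rank (flatA T alpha) <= r)%N].

(* Rank loci have integer codimension >= 0, so the infimum is a minimum. *)
Definition geometric_rank (R : realType) (a b c : nat) (T : tensor R a b c) :
    \bar R :=
  ereal_inf (range (fun r : nat => proj_codim (rank_locus T r) + r%:R%:E)%E).

Definition achieves_GR (R : realType) (a b c : nat) (T : tensor R a b c)
    (r : nat) : Prop :=
  geometric_rank T = (proj_codim (rank_locus T r) + r%:R%:E)%E.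

Definition degenerate_GR (R : realType) (a b c : nat) (T : tensor R a b c) :
    Prop :=
  (geometric_rank T < (minn a (minn b c))%:R%:E)%E.

(* Nonzero representatives of the points of Seg(PB x PC). *)
Definition segre (R : realType) (b c : nat) : set 'M[R[i]]_(b, c) :=
  [set M | \rank M = 1%N].

(* For row vectors x and y, the matrix x^T *m y is the element x (x) y. *)
Definition equiv_sym2 (R : realType) (b c : nat) (E : set 'M[R[i]]_(b, c)) :
    Prop :=
  exists (b1 b2 : 'rV[R[i]]_b) (c1 c2 : 'rV[R[i]]_c),
    [/\ free [:: b1; b2], free [:: c1; c2] &
        E = [set M | M \in span [:: b1^T *m c1;
                                  b1^T *m c2 + b2^T *m c1;
                                  b2^T *m c2]]].

(* Main.v *)
Require Import Defs.
From HB Require Import structures.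
From mathcomp Require Import all_boot all_order all_algebra.
From mathcomp Require Import complex.
From mathcomp Require Import mpoly.
From mathcomp Require Import classical_sets reals constructive_ereal ereal.
From mathcomp Require Import boolp.
From mathcomp Require Import zify ring lra.
Import Order.TTheory GRing.Theory Num.Theory.
Local Open Scope classical_set_scope.
Local Open Scope ring_scope.

Set Implicit Arguments.
Unset Strict Implicit.
Unset Printing Implicit Defensive.

(** Write Y1 and Y2 for the rank 1 and rank 2 loci.  Since the rank 1 locus
    achieves GR(T), comparing its value with that of r = 2 gives
    dim Y2 <= dim Y1 + 1, and degeneracy gives dim Y1 >= 1
    ([GR_rank1_chains]).  Take a longest chain of irreducible closed subsets of
    Y1 and let Z be its last member; it has more than one point.

    Suppose that alternative (a) fails.  If x and y are distinct points of Y1,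
    with matrices b1 (x) c1 and b2 (x) c2, then b1, b2 are independent and so
    are c1, c2: otherwise the line xy maps into the Segre variety
    ([segre_line]).  So x + y has rank exactly 2 and no line xy lies in Z.  For
    u in Z, let J(u) be the closure of the cone over Z with vertex u, and J the
    closure of the union of the secants of Z.  All these sets are irreducible,
    have rank at most 2, and satisfy Z < J(u) <= J, the first inclusion being
    strict.  Appending J(u) to the chain makes the dimension of Y2 exactly
    dim Y1 + 1, so that the rank 2 locus achieves GR(T) too; appending J as
    well would make it larger still, hence J(u) = J for every u in Z.

    Now let x, y, z be three distinct points of Z ([third_point]), with matrices
    b1 (x) c1, b2 (x) c2 and b3 (x) c3.  For every point of the cone with vertex
    z, the row space of its matrix and c3 together span at most 2 dimensions.
    This condition is closed, so it holds on J(z) = J, in particular at x + y,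
    whose row space is the plane <c1, c2>.  Thus c3 lies in <c1, c2>, and by
    symmetry b3 lies in <b1, b2> ([secant_span]).  After rescaling,
    b3 = b1 + b2 and c3 = c1 + c2, so that x, y, z span a copy of the symmetric
    2 x 2 matrices ([sym2_quotient]).

    Dimension theory enters only through the existence of a longest chain.
    Lengths of chains are bounded because a chain X_0 < ... < X_j carries N^j
    independent functions of degree O(N) on X_j ([chain_independent]), while the
    polynomials of degree O(N) in n variables form a space of dimension
    O(N^n). *)

(** * Zariski irreducibility of subsets of affine space *)

Definition vanishes (K : numFieldType) (n : nat) (p : {mpoly K[n]})
    (S : set 'rV[K]_n) : Prop :=
  forall v, S v -> p.@[fun i => v 0 i] = 0.

(** The subset S need not be closed: this is irreducibility of its Zariski
    closure in affine space, that is, primality of its vanishing ideal. *)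
Definition irreducible (K : numFieldType) (n : nat) (S : set 'rV[K]_n) : Prop :=
  S !=set0 /\
  forall p q : {mpoly K[n]}, vanishes (p * q) S -> vanishes p S \/ vanishes q S.

Definition scaling_invariant (K : numFieldType) (n : nat) (S : set 'rV[K]_n) :
    Prop :=
  forall v (t : K), t != 0 -> S v -> S (t *: v).

Lemma poly_inf_roots (K : numFieldType) (q : {poly K}) :
  (forall t, t != 0 -> q.[t] = 0) -> q = 0.
Proof.
move=> q0; have [//|nz_q] := eqVneq q 0.
have := @max_poly_roots K q [seq (i.+1%:R : K) | i <- iota 0 (size q)] nz_q.
rewrite size_map size_iota ltnn => H; have : false; last by [].
apply: H.
  apply/allP => _ /mapP[i _ ->]; rewrite rootE q0 ?pnatr_eq0 //.
by rewrite map_inj_uniq ?iota_uniq // => i j /eqP; rewrite eqr_nat => /eqP[].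
Qed.

Lemma poly_inf_mul (K : numFieldType) (p q : {poly K}) :
  (forall t, t != 0 -> p.[t] * q.[t] = 0) -> p = 0 \/ q = 0.
Proof.
move=> pq0.
have /eqP : p * q = 0.
  by apply: poly_inf_roots => t /pq0; rewrite hornerM.
by rewrite mulf_eq0 => /orP[] /eqP ->; [left | right].
Qed.

Lemma meval_line (K : numFieldType) (n : nat) (p : {mpoly K[n]})
    (w v : 'rV[K]_n) :
  exists q : {poly K}, forall t, p.@[fun i => (w + t *: v) 0 i] = q.[t].
Proof.
exists (\sum_(m <- msupp p)
  (p@_m)%:P * \prod_i ((w 0 i)%:P + v 0 i *: 'X) ^+ m i) => t.
rewrite mevalE horner_sum; apply: eq_bigr => m _.
rewrite hornerCM horner_prod; congr (_ * _); apply: eq_bigr => i _.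
by rewrite horner_exp hornerD hornerC hornerZ hornerX !mxE [t * _]mulrC.
Qed.

(** If some p in F and some q in G were both nonzero somewhere on S, the product
    p q would nevertheless vanish on S, against primality. *)
Lemma irreducible_sets (K : numFieldType) (n : nat) (S : set 'rV[K]_n)
    (F G : set {mpoly K[n]}) :
  irreducible S ->
  (forall v, S v -> (forall p, F p -> p.@[fun i => v 0 i] = 0) \/
                    (forall p, G p -> p.@[fun i => v 0 i] = 0)) ->
  (forall p, F p -> vanishes p S) \/ (forall p, G p -> vanishes p S).
Proof.
move=> [_ irrS] SFG.
have [?|/existsNP[p /not_implyP[Fp Np]]] :=
  pselect (forall p, F p -> vanishes p S).
  by left.
right=> q Gq; have [v Sv|//|//] := irrS p q.
rewrite mevalM.
by case: (SFG v Sv) => [/(_ p Fp)|/(_ q Gq)] ->; rewrite ?mul0r ?mulr0.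
Qed.

(** For cones, the cone over the union of the lines that meet both sets. *)
Definition join_set (K : numFieldType) (n : nat) (S S' : set 'rV[K]_n) :
    set 'rV[K]_n :=
  [set v | exists x y, [/\ S x, S' y & v = x + y]].

Definition line_set (K : numFieldType) (n : nat) (x : 'rV[K]_n) :
    set 'rV[K]_n :=
  [set t *: x | t in setT].

Lemma join_scaling_invariant (K : numFieldType) (n : nat)
    (S S' : set 'rV[K]_n) :
  scaling_invariant S -> scaling_invariant S' ->
    scaling_invariant (join_set S S').
Proof.
move=> invS invS' _ t nz_t [x [y [Sx S'y ->]]].
by exists (t *: x), (t *: y); split;
  [exact: invS | exact: invS' | rewrite scalerDr].
Qed.

Lemma line_scaling_invariant (K : numFieldType) (n : nat) (x : 'rV[K]_n) :
  scaling_invariant (line_set x).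
Proof. by move=> _ t _ [s _ <-]; exists (t * s); rewrite ?scalerA. Qed.

(** If a product p q vanishes on the join, then for each fixed x in S one of
    p (x + _) and q (x + _) vanishes on S'.  This covers S by two closed sets,
    whose equations are the translates of p and of q by the points of S'. *)
Lemma irreducible_sum (K : numFieldType) (n : nat) (S S' : set 'rV[K]_n) :
  irreducible S -> irreducible S' ->
  irreducible (join_set S S').
Proof.
move=> irrS irrS'; split.
  case: irrS.1 irrS'.1 => x Sx [y Sy]; by exists (x + y), x, y.
move=> p q pq0.
(* sh r w is the translate r (_ + w) *)
pose sh (r : {mpoly K[n]}) (w : 'rV[K]_n) :=
  r \mPo [tuple 'X_i + (w 0 i)%:MP | i < n].
have shE r (w v : 'rV[K]_n) :
    (sh r w).@[fun i => v 0 i] = r.@[fun i => (v + w) 0 i].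
  rewrite comp_mpoly_meval; apply: meval_eq => i.
  by rewrite tnth_mktuple mevalD mevalXU mevalC mxE.
have := @irreducible_sets _ _ S [set sh p y | y in S'] [set sh q y | y in S']
  irrS.
case=> [x Sx||].
- have [|pS'|qS'] := irrS'.2 (sh p x) (sh q x).
  + move=> y S'y; rewrite mevalM !shE [y + x]addrC -mevalM.
    by apply: pq0; exists x, y.
  + by left=> _ [y S'y <-]; rewrite shE addrC -shE; apply: pS'.
  + by right=> _ [y S'y <-]; rewrite shE addrC -shE; apply: qS'.
- move=> H; left=> _ [x [y [Sx S'y ->]]]; rewrite -shE.
  by apply: (H (sh p y)) => //; exists y.
- move=> H; right=> _ [x [y [Sx S'y ->]]]; rewrite -shE.
  by apply: (H (sh q y)) => //; exists y.
Qed.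

Lemma irreducible_line (K : numFieldType) (n : nat) (x : 'rV[K]_n) :
  irreducible (line_set x).
Proof.
split; first by exists (0 *: x), 0.
move=> p q pq0.
have [[p' p'E] [q' q'E]] := (meval_line p 0 x, meval_line q 0 x).
case: (@poly_inf_mul _ p' q') => [t _|p0|q0].
- rewrite -p'E -q'E -mevalM add0r; apply: pq0; by exists t.
- by left=> _ [t _ <-]; rewrite -[t *: x]add0r p'E p0 horner0.
- by right=> _ [t _ <-]; rewrite -[t *: x]add0r q'E q0 horner0.
Qed.

(** A multiple of x that is nonzero belongs to Z; for the vertex multiple 0,
    a point z of Z is the sum of its two halves. *)
Lemma cone_sub_secant (K : numFieldType) (n : nat) (Z : set 'rV[K]_n) x :
  scaling_invariant Z -> Z x -> join_set Z (line_set x) `<=` join_set Z Z.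
Proof.
move=> invZ Zx _ [z [_ [Zz [t _ <-] ->]]].
have [->|nz_t] := eqVneq t 0; last by exists z, (t *: x); split=> //;
  apply: invZ.
have nz2 : 2%:R^-1 != 0 :> K by rewrite invr_eq0 pnatr_eq0.
exists (2%:R^-1 *: z), (2%:R^-1 *: z); split; [exact: invZ | exact: invZ |].
rewrite scale0r addr0 -scalerDl (_ : _ + _ = 1) ?scale1r //.
by field.
Qed.

(** Rank at most r is a closed condition: if the rank at v exceeds r, constant
    matrices P and Q make P M(v) Q the identity of size r + 1, and the
    determinant of P M Q is a polynomial that separates v from S. *)
Lemma rank_le_closed (K : numFieldType) (n p q r : nat) (S : set 'rV[K]_n)
    (M : 'M[{mpoly K[n]}]_(p, q)) (v : 'rV[K]_n) :
  (forall f, vanishes f S -> f.@[fun i => v 0 i] = 0) ->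
  (forall u, S u -> (\rank (map_mx (meval (fun i => u 0%R i)) M) <= r)%N) ->
  (\rank (map_mx (meval (fun i => v 0%R i)) M) <= r)%N.
Proof.
move=> vS rkS; set N := map_mx _ M; rewrite leqNgt; apply/negP => ltr.
have [P [Q PNQ]] : exists (P : 'M[K]_(r.+1, p)) (Q : 'M[K]_(q, r.+1)),
    P *m N *m Q = 1%:M.
  exists (pid_mx r.+1 *m invmx (col_ebase N)).
  exists (invmx (row_ebase N) *m pid_mx r.+1).
  have := leq_trans ltr (rank_leq_row N).
  have := leq_trans ltr (rank_leq_col N).
  move: (mulmx_ebase N) (col_ebase_unit N) (row_ebase_unit N) ltr.
  move: (col_ebase N) (row_ebase N) (\rank N) => L U k <- uL uU.
  rewrite !mulmxA mulmxKV // mulmxK // !mul_pid_mx -pid_mx_1.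
  move=> /minn_idPl -> /minn_idPr qr /minn_idPr pr.
  by rewrite pr minnn qr.
pose f : {mpoly K[n]} :=
  \det (map_mx (@mpolyC n K) P *m M *m map_mx (@mpolyC n K) Q).
have fE (u : 'rV[K]_n) : f.@[fun i => u 0 i] =
    \det (P *m map_mx (meval (fun i => u 0 i)) M *m Q).
  rewrite -det_map_mx !map_mxM -!map_mx_comp; congr (\det (_ *m _ *m _)).
    by apply/matrixP => i j; rewrite !mxE /= mevalC.
  by apply/matrixP => i j; rewrite !mxE /= mevalC.
have /eqP : f.@[fun i => v 0 i] = 0.
  apply: vS => u Su; rewrite fE; apply/eqP; rewrite -[_ == 0]negbK -unitfE
    -unitmxE.
  apply/negP => /mxrank_unit rkD; have := rkS u Su; apply/negP; rewrite -ltnNge.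
  rewrite -[X in (X <= _)%N]rkD; apply: leq_trans (mxrankM_maxl _ _) _.
  exact: mxrankM_maxr.
by rewrite fE -/N PNQ det1 oner_eq0.
Qed.

(** * Homogeneous components and projective closure *)

Lemma meval_homog (K : numFieldType) (n d : nat) (p : {mpoly K[n]}) (t : K)
    (v : 'rV[K]_n) :
  p \is d.-homog -> p.@[fun i => (t *: v) 0 i] = t ^+ d * p.@[fun i => v 0 i].
Proof.
move=> /dhomogP hp; rewrite !mevalE mulr_sumr !big_seq; apply: eq_bigr => m mp.
rewrite mulrCA; congr (_ * _).
rewrite -(hp m mp) /= mdegE -prodrXr -big_split /=; apply: eq_bigr => i _.
by rewrite mxE exprMn.
Qed.

(** Restriction to a ray separates the homogeneous components: they become the
    coefficients of a univariate polynomial. *)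
Lemma meval_ray (K : numFieldType) (n : nat) (p : {mpoly K[n]}) (v : 'rV[K]_n)
    (t : K) :
  p.@[fun i => (t *: v) 0 i] =
  (\poly_(d < msize p) (pihomog mdeg d p).@[fun i => v 0 i]).[t].
Proof.
rewrite horner_poly [p in LHS](@pihomog_partitionE _ _ mdeg (msize p)) //.
rewrite raddf_sum /=; apply: eq_bigr => d _.
by rewrite (@meval_homog _ _ d) ?pihomogP // mulrC.
Qed.

Lemma meval_eq0_pihomog (K : numFieldType) (n : nat) (p : {mpoly K[n]})
    (v : 'rV[K]_n) :
  (forall d, (pihomog mdeg d p).@[fun i => v 0 i] = 0) ->
  p.@[fun i => v 0 i] = 0.
Proof.
move=> p0; rewrite [p](@pihomog_partitionE _ _ mdeg (msize p)) //.
by rewrite raddf_sum /= big1.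
Qed.

Lemma pihomog_vanishes_ray (K : numFieldType) (n : nat) (p : {mpoly K[n]})
    (v : 'rV[K]_n) :
  (\poly_(d < msize p) (pihomog mdeg d p).@[fun i => v 0 i]) = 0 ->
  forall d, (pihomog mdeg d p).@[fun i => v 0 i] = 0.
Proof.
move=> q0 d; have [ltdp|lepd] := ltnP d (msize p).
  by have := congr1 (fun q : {poly K} => q`_d) q0; rewrite coef_poly ltdp coef0.
suff -> : pihomog mdeg d p = 0 by rewrite meval0.
rewrite pihomogE big_seq_cond big_pred0 // => m;
  apply/negP => /andP[mp /eqP dm].
by have := msize_mdeg_lt mp; rewrite dm ltnNge lepd.
Qed.

Lemma vanishes_pihomog (K : numFieldType) (n : nat) (p : {mpoly K[n]})
    (S : set 'rV[K]_n) d :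
  scaling_invariant S -> vanishes p S -> vanishes (pihomog mdeg d p) S.
Proof.
move=> invS pS v Sv; apply: pihomog_vanishes_ray.
by apply: poly_inf_roots => t nz_t; rewrite -meval_ray; apply/pS/invS.
Qed.

Lemma proj_closed_scaling_invariant (R : realType) (n : nat)
    (Y : set 'rV[R[i]]_n) :
  proj_closed Y -> scaling_invariant Y.
Proof.
move=> [S homS ->] v t nz_t [nz_v v0]; split.
  by rewrite scaler_eq0 negb_or nz_t.
move=> p Sp; have [d hp] := homS p Sp.
by rewrite (meval_homog _ _ hp) v0 ?mulr0.
Qed.

(** Projective irreducibility only concerns homogeneous equations.  When a
    product p q vanishes on Y, its restriction to the ray through any v in Y
    vanishes, so the restriction of p or that of q does; hence the homogeneous
    components of p and those of q define closed sets that cover Y. *)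
Lemma proj_irreducible_closed_irreducible (R : realType) (n : nat)
    (Y : set 'rV[R[i]]_n) :
  proj_irreducible_closed Y -> irreducible Y.
Proof.
move=> [clY neY irrY]; split=> // p q pq0.
pose comps (f : {mpoly R[i][n]}) := [set pihomog mdeg d f | d in setT].
have clc f : proj_closed (proj_zeros (comps f)).
  by exists (comps f) => // _ [d _ <-]; exists d; apply: pihomogP.
have zero f : Y `<=` proj_zeros (comps f) -> vanishes f Y.
  move=> sub v Yv; apply: meval_eq0_pihomog => d.
  by case: (sub v Yv) => _; apply; exists d.
have nz v : Y v -> v != 0 by case: clY => S _ -> [].
case: (irrY _ _ (clc p) (clc q)) => [v Yv|/zero ?|/zero ?]; [|by left|by right].
have [|p0|q0] := @poly_inf_mul _
  (\poly_(d < msize p) (pihomog mdeg d p).@[fun i => v 0 i])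
  (\poly_(d < msize q) (pihomog mdeg d q).@[fun i => v 0 i]).
- move=> t nz_t; rewrite -!meval_ray -mevalM; apply: pq0.
  exact: (proj_closed_scaling_invariant clY).
- by left; split=> [|_ [d _ <-]]; [apply: nz | apply: pihomog_vanishes_ray].
- by right; split=> [|_ [d _ <-]]; [apply: nz | apply: pihomog_vanishes_ray].
Qed.

Definition proj_closure (R : realType) (n : nat) (S : set 'rV[R[i]]_n) :
    set 'rV[R[i]]_n :=
  proj_zeros [set p | (exists d : nat, p \is d.-homog) /\ vanishes p S].

Lemma sub_proj_closure (R : realType) (n : nat) (S : set 'rV[R[i]]_n) v :
  S v -> v != 0 -> proj_closure S v.
Proof. by move=> Sv nz_v; split=> // p [_]; apply. Qed.

Lemma proj_closureS (R : realType) (n : nat) (S S' : set 'rV[R[i]]_n) :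
  S `<=` S' -> proj_closure S `<=` proj_closure S'.
Proof.
move=> sSS' v [nz_v v0]; split=> // p [hp pS']; apply: v0; split=> // u /sSS'.
exact: pS'.
Qed.

Lemma proj_closure_vanishes (R : realType) (n : nat) (S : set 'rV[R[i]]_n) f v :
  scaling_invariant S -> proj_closure S v -> vanishes f S ->
  f.@[fun i => v 0 i] = 0.
Proof.
move=> invS [_ v0] fS; apply: meval_eq0_pihomog => d; apply: v0; split.
  by exists d; apply: pihomogP.
exact: vanishes_pihomog.
Qed.

Lemma proj_closure_irreducible (R : realType) (n : nat)
    (S : set 'rV[R[i]]_n) v :
  irreducible S -> S v -> v != 0 -> proj_irreducible_closed (proj_closure S).
Proof.
move=> irrS Sv nz_v; split; [|by exists v; apply: sub_proj_closure|].
  by exists [set p | (exists d : nat, p \is d.-homog) /\ vanishes p S] =>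
    // p [].
move=> Z1 Z2 [S1 homS1 ->] [S2 homS2 ->] sub12.
have sub1 F : (forall p, F p -> exists d, p \is d.-homog) ->
    (forall p, F p -> vanishes p S) -> proj_closure S `<=` proj_zeros F.
  by move=> homF FS u [nz_u u0]; split=> // p Fp; apply: u0; split;
    [apply: homF | apply: FS].
(* the coordinate 'X_j, nonzero at v, discards a possible zero vector of S *)
have /rV0Pn[j nz_vj] := nz_v.
have key : (forall f, [set p * 'X_j | p in S1] f -> vanishes f S) \/
    (forall f, [set p * 'X_j | p in S2] f -> vanishes f S).
  apply: irreducible_sets irrS _ => u Su; have [->|nz_u] := eqVneq u 0.
    by left=> _ [p _ <-]; rewrite mevalM mevalXU mxE mulr0.
  case: (sub12 u (sub_proj_closure Su nz_u)) => -[_ u0]; [left|right].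
    by move=> _ [p Sp <-]; rewrite mevalM u0 ?mul0r.
  by move=> _ [p Sp <-]; rewrite mevalM u0 ?mul0r.
have cancelX p : vanishes (p * 'X_j) S -> vanishes p S.
  case/irrS.2 => // /(_ v Sv); rewrite mevalXU => vj0;
    by rewrite vj0 eqxx in nz_vj.
case: key => key; [left|right]; apply: sub1 => // p Sp; apply: cancelX;
  apply: key; by exists p.
Qed.

(** * Chains of irreducible closed sets have bounded length *)

(** Independent polynomials of degree less than D are at most as many as the
    monomials of degree less than D, whose exponents are all less than D. *)
Lemma independent_mpoly_card (K : numFieldType) (n D : nat) (I : finType)
    (g : I -> {mpoly K[n]}) :
  (forall i, (msize (g i) <= D)%N) ->
  (forall c : I -> K, \sum_i c i *: g i = 0 -> forall i, c i = 0) ->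
  (#|I| <= D ^ n)%N.
Proof.
move=> szg indg; pose J : finType := 'X_{1..n < D}.
pose M : 'M[K]_(#|I|, #|J|) :=
  \matrix_(i, j) (g (enum_val i))@_(enum_val j : J).
have freeM : row_free M.
  rewrite -kermx_eq0; apply/negPn/negP => /rowV0Pn[u /sub_kermxP uM nz_u].
  case/rV0Pn: nz_u => l; apply/negP; rewrite negbK; apply/eqP.
  rewrite -[l]enum_valK; apply: (indg (fun i => u 0 (enum_rank i))).
  apply/mpolyP => m; rewrite mcoeff0 raddf_sum /=.
  have [ltmD|leDm] := ltnP (mdeg m) D; last first.
    rewrite big1 // => k _; rewrite mcoeffZ memN_msupp_eq0 ?mulr0 //.
    by apply: msize_mdeg_ge; apply: leq_trans leDm.
  have := congr1 (fun w : 'rV_ _ => w 0 (enum_rank (BMultinom ltmD : J))) uM.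
  rewrite !mxE => uM0; rewrite -[RHS]uM0 [RHS](reindex enum_rank) /=;
    last first.
    by apply: onW_bij; apply: enum_rank_bij.
  by apply: eq_bigr => k _; rewrite mcoeffZ mxE !enum_rankK.
have -> : #|I| = \rank M by rewrite (eqP freeM).
apply: leq_trans (rank_leq_col _) _.
have bnd (m : J) i : (bmnm m i < D)%N.
  by apply: leq_ltn_trans (bmdeg m); rewrite mdegE (bigD1 i) //= leq_addr.
pose h (m : J) : {ffun 'I_n -> 'I_D} := [ffun i => Ordinal (bnd m i)].
have injh : injective h.
  move=> m1 m2 /ffunP eqh; apply/val_inj/mnmP => i.
  by have := congr1 val (eqh i); rewrite !ffunE.
by apply: leq_trans (leq_card _ injh) _; rewrite card_ffun !card_ord.
Qed.

Lemma irreducible_cancelX (K : numFieldType) (n : nat) (S : set 'rV[K]_n)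
    (f h : {mpoly K[n]}) b :
  irreducible S -> ~ vanishes f S -> vanishes (f ^+ b * h) S -> vanishes h S.
Proof.
move=> irrS nf; elim: b => [|b IH]; first by rewrite expr0 mul1r.
by rewrite exprS -mulrA => /irrS.2[/nf|/IH].
Qed.

Lemma msize_exp_le (K : numFieldType) (n : nat) (f : {mpoly K[n]}) b :
  (msize (f ^+ b) <= (b * (msize f).+1).+1)%N.
Proof.
elim: b => [|b IH]; first by rewrite expr0 msize1.
by rewrite exprS; apply: leq_trans (msizeM_le _ _) _; move: IH; lia.
Qed.

(** A weak form of the statement that the Hilbert function of X_j grows at
    least like N^j.  If f vanishes on X_j but not on X_(j+1), and the g_a are
    independent on X_j, then the products f^b g_a with b < N are independent on
    X_(j+1): in a relation, the power of f of least exponent can be cancelled,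
    and what remains restricts to a relation between the g_a on X_j. *)
Lemma chain_independent (K : numFieldType) (n k : nat)
    (X : nat -> set 'rV[K]_n) :
  (forall j, (j < k)%N -> irreducible (X j)) ->
  (forall j, (j.+1 < k)%N -> X j `<=` X j.+1 /\
     exists2 f : {mpoly K[n]}, vanishes f (X j) & ~ vanishes f (X j.+1)) ->
  forall j, (j < k)%N -> exists E : nat, forall N : nat, (0 < N)%N ->
    exists (I : finType) (g : I -> {mpoly K[n]}),
      [/\ #|I| = (N ^ j)%N, forall a, (msize (g a) <= N * E)%N &
          forall c : I -> K, vanishes (\sum_a c a *: g a) (X j) ->
            forall a, c a = 0].
Proof.
move=> irrX stepX; elim=> [|j IH] ltjk.
  exists 1%N => N N_gt0; exists unit, (fun=> 1); split.
  - by rewrite card_unit expn0.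
  - by move=> _; rewrite msize1 muln1.
  move=> c c0 [].
  have [[v Xv] _] := irrX 0%N ltjk.
  have := c0 v Xv; by rewrite (big_pred1 tt) ?mevalZ ?meval1 ?mulr1 // => -[].
have [E indE] := IH (ltnW ltjk).
have [subX [f fX fX']] := stepX j ltjk.
exists (E + (msize f).+4)%N => N N_gt0.
have [I [g [cardI szg indg]]] := indE N N_gt0.
exists ('I_N * I)%type, (fun ba => f ^+ (val ba.1) * g ba.2); split.
- by rewrite card_prod card_ord cardI expnS.
- move=> [b a] /=; apply: leq_trans (msizeM_le _ _) _.
  have := msize_exp_le f b; have := szg a; have := ltn_ord b.
  move: (val b) => b' ltb sza szb.
  have : (b' * (msize f).+1 <= N * (msize f).+1)%N by rewrite leq_mul2r ltnW
    ?orbT.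
  rewrite mulnDr; move: szb; lia.
move=> c c0.
pose h (b : 'I_N) := \sum_a c (b, a) *: g a.
have sumE : \sum_ba c ba *: (f ^+ (val ba.1) * g ba.2) =
    \sum_b f ^+ (val b) * h b.
  rewrite (eq_bigr (fun ba : 'I_N * I =>
     c (ba.1, ba.2) *: (f ^+ (val ba.1) * g ba.2))); last by case.
  rewrite -(pair_bigA _ (fun b a => c (b, a) *: (f ^+ (val b) * g a))) /=.
  apply: eq_bigr => b _; rewrite mulr_sumr; apply: eq_bigr => a _.
  by rewrite scalerAr.
suff all_b d (b : 'I_N) : (val b < d)%N -> forall a, c (b, a) = 0.
  by case=> b a; apply: all_b (ltnSn b) a.
elim: d b => // d IHd b ltbd; apply: indg.
have h0 (b' : 'I_N) : (b' < b)%N -> h b' = 0.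
  by move=> ltb; rewrite /h big1 // => a _; rewrite IHd ?scale0r //
    (leq_trans ltb).
pose rest := \sum_(b' < N | (b < b')%N) f ^+ (b' - b.+1) * h b'.
(* b is the least exponent left in the relation *)
have : vanishes (f ^+ b * (h b + f * rest)) (X j.+1).
  suff <- : \sum_b f ^+ (val b) * h b = f ^+ b * (h b + f * rest).
    by rewrite -sumE.
  rewrite (bigD1 b) //= mulrDr; congr (_ + _).
  rewrite mulr_sumr mulr_sumr big_mkcond [RHS]big_mkcond;
    apply: eq_bigr => b' _ /=.
  case: (ltngtP b b') => [ltbb'|ltb'b|eqbb'].
  - rewrite -(inj_eq val_inj) /= gtn_eqF // !mulrA; congr (_ * _).
    by rewrite -exprSr -exprD subnKC.
  - by rewrite h0 // mulr0 if_same.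
  - by rewrite (val_inj eqbb') eqxx.
move/(irreducible_cancelX (irrX _ ltjk) fX') => hX v Xv.
by have := hX v (subX v Xv); rewrite mevalD mevalM fX // mul0r addr0.
Qed.

(** The bound is not sharp: a chain in P^(n-1) has at most n members. *)
Lemma irreducible_chain_bound (R : realType) (n k : nat)
    (Y : set 'rV[R[i]]_n) X :
  irreducible_chain Y k X -> (k <= n.+1)%N.
Proof.
move=> [irrX ltX]; rewrite leqNgt; apply/negP => ltnk.
have irrX' j : (j < k)%N -> irreducible (X j).
  by move/irrX => [/proj_irreducible_closed_irreducible].
have [j ltjk|E indE] := chain_independent irrX' _ ltnk.
  have [subX [v /not_implyP[Xv nXv]]] : X j `<=` X j.+1 /\
      exists v, ~ (X j.+1 v -> X j v).
    by have [sub nsub] := ltX j ltjk; split=> //; apply/existsNP => /nsub.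
  split=> //; have [[[S _ XE] _ _] _] := irrX j (ltnW ltjk).
  have [[[S' _ XE'] _ _] _] := irrX j.+1 ltjk.
  have nz_v : v != 0 by move: Xv; rewrite XE' => -[].
  have /existsNP[p /not_implyP[Sp pv]] : ~ forall p, S p ->
    p.@[fun i => v 0 i] = 0.
    by move=> H; apply: nXv; rewrite XE.
  exists p; last by move/(_ v Xv).
  by move=> u; rewrite XE => -[_]; apply.
have [I [g [cardI szg indg]]] := indE (E ^ n).+1 isT.
have := independent_mpoly_card szg _; rewrite cardI => H.
have : ((E ^ n).+1 ^ n.+1 <= ((E ^ n).+1 * E) ^ n)%N.
  by apply: H => c c0; apply: indg => v _; rewrite c0 meval0.
by rewrite expnMn expnS mulnC leq_pmul2l ?expn_gt0 // ltnn.
Qed.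

(** Chain lengths being bounded, the supremum that defines the dimension is
    attained. *)
Lemma proj_dim_chain (R : realType) (n : nat) (Y : set 'rV[R[i]]_n) :
  exists k : nat, [/\ proj_dim Y = ((k%:R - 1)%:E)%E,
    exists X, irreducible_chain Y k X &
    forall k' X, irreducible_chain Y k' X -> (k' <= k)%N].
Proof.
pose P k := `[< exists X, irreducible_chain Y k X >].
have exP : exists k, P k by exists 0%N; apply/asboolP; exists (fun=> set0).
have ubP k : P k -> (k <= n.+1)%N.
  by move=> /asboolP[X /irreducible_chain_bound].
have [k /asboolP[X chX] kmax] := ex_maxnP exP ubP.
have {}kmax k' X' : irreducible_chain Y k' X' -> (k' <= k)%N.
  by move=> chX'; apply/kmax/asboolP; exists X'.
exists k; split=> //; last by exists X.
apply/eqP; rewrite eq_le; apply/andP; split.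
  apply: ge_ereal_sup => _ [k' [X' /kmax lek'k] <-].
  by rewrite lee_fin lerB // ler_nat.
by apply: ereal_sup_ubound; exists k => //; exists X.
Qed.

Lemma irreducible_chain_rcons (R : realType) (n k : nat)
    (Y Y' C : set 'rV[R[i]]_n) X :
  irreducible_chain Y k.+1 X -> Y `<=` Y' -> proj_irreducible_closed C ->
  C `<=` Y' -> X k `<` C ->
  irreducible_chain Y' k.+2 (fun j => if (j < k.+1)%N then X j else C).
Proof.
move=> [irrX ltX] YY' irrC CY' XC; split=> j ltj.
  case: ifP => [/irrX[irrXj XjY]|_]; split=> //.
  exact: subset_trans YY'.
rewrite ltnS in ltj; rewrite ltj; case: ifP => [/ltX //|].
move/negbT; rewrite -leqNgt ltnS => lekj.
by have -> : j = k by apply/eqP; rewrite eqn_leq -ltnS ltj.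
Qed.

(** * Linear algebra of rank one matrices *)

Definition indep2 (K : fieldType) (V : lmodType K) (x y : V) : Prop :=
  forall s t : K, s *: x + t *: y = 0 -> s = 0 /\ t = 0.

Lemma indep2C (K : fieldType) (V : lmodType K) (x y : V) :
  indep2 x y -> indep2 y x.
Proof. by move=> xy s t; rewrite addrC => /xy[]. Qed.

Lemma indep2_neq0 (K : fieldType) (V : lmodType K) (x y : V) :
  indep2 x y -> x + y != 0.
Proof.
move=> xy; apply/eqP => xy0; have [|/eqP] := xy 1 1; first by rewrite !scale1r.
by rewrite oner_eq0.
Qed.

Lemma proportional_indep2N (K : fieldType) (V : lmodType K) (x : V) t :
  ~ indep2 x (t *: x).
Proof.
move/(_ (- t) 1) => []; first by rewrite scale1r scaleNr addNr.
by move=> _ /eqP; rewrite oner_eq0.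
Qed.

Lemma indep2_coef_neq0 (K : fieldType) (V : lmodType K) (x y : V) s t :
  indep2 x (s *: x + t *: y) -> t != 0.
Proof.
move=> xy; apply/eqP => t0; move: xy; rewrite t0 scale0r addr0.
exact: proportional_indep2N.
Qed.

Lemma indep2Z (K : fieldType) (V : lmodType K) (x y : V) s t :
  s != 0 -> t != 0 -> indep2 x y -> indep2 (s *: x) (t *: y).
Proof.
move=> nz_s nz_t xy a b; rewrite !scalerA => /xy[/eqP + /eqP].
by rewrite !mulf_eq0 (negbTE nz_s) (negbTE nz_t) !orbF => /eqP -> /eqP ->.
Qed.

Lemma indep2_free (K : fieldType) (V : vectType K) (x y : V) :
  indep2 x y -> free [:: x; y].
Proof.
move=> xy; rewrite free_cons span_seq1 free_cons span_nil memv0 nil_free andbT.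
apply/andP; split.
  apply/negP => /vlineP[t xE]; have [|/eqP] := xy 1 (- t).
    by rewrite xE scale1r scaleNr subrr.
  by rewrite oner_eq0.
apply/eqP => y0; have [|_ /eqP] := xy 0 1; first by rewrite y0 scaler0 scale0r
  addr0.
by rewrite oner_eq0.
Qed.

Lemma indep2P (K : fieldType) (n : nat) (x y : 'rV[K]_n) :
  reflect (indep2 x y) (row_free (col_mx x y)).
Proof.
apply: (iffP idP) => [free_xy s t st0|xy].
  have /(congr1 (mulmxr (pinvmx (col_mx x y)))) :
      row_mx s%:M t%:M *m col_mx x y = 0 :> 'rV_n.
    by rewrite mul_row_col !mul_scalar_mx.
  rewrite /= mul0mx mulmxKp // -row_mx0 => /eq_row_mx[/matrixP/(_ 0 0) s0
    /matrixP/(_ 0 0) t0].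
  by move: s0 t0; rewrite !mxE eqxx !mulr1n.
rewrite -kermx_eq0; apply/negPn/negP => /rowV0Pn[u /sub_kermxP].
rewrite -[u]hsubmxK mul_row_col [lsubmx u]mx11_scalar [rsubmx u]mx11_scalar.
rewrite !mul_scalar_mx => /xy[-> ->].
by rewrite !raddf0 /= row_mx0 eqxx.
Qed.

Lemma not_indep2_minors (K : fieldType) (n : nat) (x y : 'rV[K]_n) :
  ~ indep2 x y -> forall l j, x 0 l * y 0 j = x 0 j * y 0 l.
Proof.
move=> /existsNP[s /existsNP[t /not_implyP[/rowP xy0 st0]]] l j.
have := xy0 l; have := xy0 j; rewrite !mxE => xyj xyl.
have tE : t * (x 0 l * y 0 j - x 0 j * y 0 l) = 0.
  have -> : t * (x 0 l * y 0 j - x 0 j * y 0 l) =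
    x 0 l * (s * x 0 j + t * y 0 j) - x 0 j * (s * x 0 l + t * y 0 l) by ring.
  by rewrite xyl xyj !mulr0 subrr.
have sE : s * (x 0 l * y 0 j - x 0 j * y 0 l) = 0.
  have -> : s * (x 0 l * y 0 j - x 0 j * y 0 l) =
    (s * x 0 l + t * y 0 l) * y 0 j - (s * x 0 j + t * y 0 j) * y 0 l by ring.
  by rewrite xyl xyj !mul0r subrr.
move/eqP: tE; move/eqP: sE; rewrite !mulf_eq0 subr_eq0.
have [//|nxy] := eqVneq (x 0 l * y 0 j) _.
by rewrite !orbF => /eqP s0 /eqP t0; case: st0.
Qed.

Lemma minors0_proportional (K : fieldType) (n : nat) (x y : 'rV[K]_n) :
  x != 0 -> y != 0 -> (forall l j, x 0 l * y 0 j = x 0 j * y 0 l) ->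
  exists2 t, t != 0 & y = t *: x.
Proof.
move=> /rV0Pn[l nz_xl] nz_y xy; have yE : y = (y 0 l / x 0 l) *: x.
  apply/rowP => j; rewrite !mxE mulrAC [y 0 l * _]mulrC -xy mulrAC mulfV ?mul1r
    //.
exists (y 0 l / x 0 l) => //.
by apply: contraNneq nz_y => t0; rewrite yE t0 scale0r.
Qed.

Lemma indep2_outer_eq0 (K : fieldType) (m n : nat) (b1 b2 : 'rV[K]_m)
    (d1 d2 : 'rV[K]_n) :
  indep2 b1 b2 -> b1^T *m d1 + b2^T *m d2 = 0 -> d1 = 0 /\ d2 = 0.
Proof.
move=> b12 /matrixP d0.
have d12 j : d1 0 j = 0 /\ d2 0 j = 0.
  apply: b12; apply/rowP => i; have := d0 i j.
  by rewrite !mxE !big_ord1 !mxE ![_ * (d1 _ _)]mulrC ![_ * (d2 _ _)]mulrC.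
by split; apply/rowP => j; rewrite mxE; case: (d12 j).
Qed.

Lemma rank_le1_outer (K : fieldType) (m n : nat) (M : 'M[K]_(m, n)) :
  (\rank M <= 1)%N -> exists (b : 'rV[K]_m) (c : 'rV[K]_n), M = b^T *m c.
Proof.
move: (mulmx_base M); move: (col_base M) (row_base M).
case: (\rank M) => [|[|//]] L U <- _.
  by exists 0, 0; rewrite mulmx0 [L]thinmx0 mul0mx.
by exists L^T, U; rewrite trmxK.
Qed.

Lemma sum_outer (K : fieldType) (m n : nat) (b1 b2 : 'rV[K]_m)
    (c1 c2 : 'rV[K]_n) :
  b1^T *m c1 + b2^T *m c2 = (col_mx b1 b2)^T *m col_mx c1 c2.
Proof. by rewrite tr_col_mx mul_row_col. Qed.

Lemma rank_sum_outer_le1 (K : fieldType) (m n : nat) (b1 b2 : 'rV[K]_m)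
    (c1 c2 : 'rV[K]_n) :
  ~ indep2 b1 b2 -> (\rank (b1^T *m c1 + b2^T *m c2)%R <= 1)%N.
Proof.
move=> nb12; rewrite sum_outer; apply: leq_trans (mxrankM_maxl _ _) _.
rewrite mxrank_tr -ltnS ltn_neqAle rank_leq_row andbT; apply/negP => fr.
by apply/nb12/indep2P.
Qed.

(** The row space of b1 (x) c1 + b2 (x) c2 is the plane spanned by c1 and c2,
    and stacking c below this matrix does not increase the rank. *)
Lemma sub_sum_outer (K : fieldType) (m n : nat) (b1 b2 : 'rV[K]_m)
    (c1 c2 c : 'rV[K]_n) :
  indep2 b1 b2 -> indep2 c1 c2 ->
  (\rank (col_mx (b1^T *m c1 + b2^T *m c2)%R c) <= 2)%N ->
  exists s t, c = s *: c1 + t *: c2.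
Proof.
move=> /indep2P b12 /indep2P c12; rewrite sum_outer; set M := _ *m _ => rk2.
have rkM : \rank M = 2%N.
  rewrite mxrankMfree // mxrank_tr; exact/eqP.
have sMc : (M <= col_mx M c)%MS by rewrite -addsmxE addsmxSl.
have : (col_mx M c <= M)%MS.
  by rewrite -(geq_leqif (mxrank_leqif_sup sMc)) rkM.
rewrite col_mx_sub => /andP[_ scM].
have /submxP[u ->] := submx_trans scM (submxMl _ _).
exists (lsubmx u 0 0), (rsubmx u 0 0).
rewrite -[u in LHS]hsubmxK mul_row_col [lsubmx u in LHS]mx11_scalar.
by rewrite [rsubmx u in LHS]mx11_scalar !mul_scalar_mx.
Qed.

(** All rows lie in the span of c and c3.  The row c3 at the bottom adds
    nothing to it, which is what makes this bound stronger than the bound 2 on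
    the rank of the upper block. *)
Lemma rank_cone_le2 (K : fieldType) (m n : nat) (b b3 : 'rV[K]_m)
    (c c3 : 'rV[K]_n) (t : K) :
  (\rank (col_mx (b^T *m c + t *: (b3^T *m c3))%R c3) <= 2)%N.
Proof.
have -> : col_mx (b^T *m c + t *: (b3^T *m c3)) c3 =
    col_mx b^T 0 *m c + col_mx (t *: b3^T) 1%:M *m c3.
  by rewrite !mul_col_mx mul0mx mul1mx scalemxAl add_col_mx add0r.
apply: leq_trans (mxrank_add _ _) _; rewrite -[2%N]/(1 + 1)%N; apply: leq_add.
  by apply: leq_trans (mxrankM_maxr _ _) (rank_leq_row _).
by apply: leq_trans (mxrankM_maxr _ _) (rank_leq_row _).
Qed.

(** The points proportional to x form a closed set, and so do those
    proportional to y; if these two sets covered Z, one of them would contain Z,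
    and so both x and y. *)
Lemma third_point (K : numFieldType) (n : nat) (Z : set 'rV[K]_n) x y :
  irreducible Z -> Z x -> Z y -> indep2 x y ->
  exists z, [/\ Z z, indep2 x z & indep2 y z].
Proof.
move=> irrZ Zx Zy xy; apply/not_existsP => noz.
(* the 2 x 2 minors of the matrix with rows u and v, as equations in v *)
pose F (u : 'rV[K]_n) : set {mpoly K[n]} :=
  [set p | exists l j, p = u 0 l *: 'X_j - u 0 j *: 'X_l].
have FE (u v : 'rV[K]_n) l j :
    (u 0 l *: 'X_j - u 0 j *: 'X_l).@[fun i => v 0 i] =
    u 0 l * v 0 j - u 0 j * v 0 l.
  by rewrite mevalB !mevalZ !mevalXU.
have nF u v : u != 0 -> v != 0 -> indep2 u v ->
    ~ (forall p, F u p -> p.@[fun i => v 0 i] = 0).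
  move=> nz_u nz_v uv Fuv; have [|t _ vE] := @minors0_proportional _ _ u v nz_u nz_v.
    move=> l j; apply/eqP; rewrite -subr_eq0 -FE; apply/eqP/Fuv; by exists l, j.
  by move: uv; rewrite vE; apply: proportional_indep2N.
have Fn u v : ~ indep2 u v -> forall p, F u p -> p.@[fun i => v 0 i] = 0.
  by move=> /not_indep2_minors uv _ [l [j ->]]; rewrite FE uv subrr.
have nz_x : x != 0.
  by apply/eqP => x0; have := @proportional_indep2N _ _ y 0;
    rewrite scale0r -x0; apply; apply: indep2C.
have nz_y : y != 0.
  by apply/eqP => y0; have := @proportional_indep2N _ _ x 0;
    rewrite scale0r -y0.
case: (@irreducible_sets _ _ Z (F x) (F y) irrZ) => [v Zv|Fx|Fy].
- have [xv|/Fn ?] := pselect (indep2 x v); last by left.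
  have [yv|/Fn ?] := pselect (indep2 y v); last by right.
  by case: (noz v).
- by apply: (nF x y) => // p /Fx; apply.
- by apply: (nF y x) => //; [apply: indep2C | move=> p /Fy; apply].
Qed.

(** * The flattening and its rank loci *)

Lemma flatA_is_linear (R : realType) (a b c : nat) (T : tensor R a b c) s u v :
  flatA T (s *: u + v) = s *: flatA T u + flatA T v.
Proof.
apply/matrixP => j k; rewrite !mxE mulr_sumr -big_split;
  apply: eq_bigr => l _ /=.
by rewrite !mxE mulrDl mulrA.
Qed.

Lemma flatAD (R : realType) (a b c : nat) (T : tensor R a b c) u v :
  flatA T (u + v) = flatA T u + flatA T v.
Proof. by rewrite -[u]scale1r flatA_is_linear !scale1r. Qed.

Lemma flatA0 (R : realType) (a b c : nat) (T : tensor R a b c) :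
  flatA T 0 = 0.
Proof. by apply: (addrI (flatA T 0)); rewrite -flatAD !addr0. Qed.

Lemma flatAZ (R : realType) (a b c : nat) (T : tensor R a b c) s u :
  flatA T (s *: u) = s *: flatA T u.
Proof. by rewrite -[s *: u]addr0 flatA_is_linear flatA0 addr0. Qed.

Definition flatA_poly (R : realType) (a b c : nat) (T : tensor R a b c) :
    'M[{mpoly R[i][a]}]_(b, c) :=
  \matrix_(j, k) \sum_l T l j k *: 'X_l.

Lemma flatA_polyE (R : realType) (a b c : nat) (T : tensor R a b c)
    (v : 'rV_a) :
  map_mx (meval (fun l => v 0 l)) (flatA_poly T) = flatA T v.
Proof.
apply/matrixP => j k; rewrite !mxE raddf_sum; apply: eq_bigr => l _ /=.
by rewrite mevalZ mevalXU mulrC.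
Qed.

Lemma map_mx_mpolyC (K : numFieldType) (n p q : nat) (M : 'M[K]_(p, q)) v :
  map_mx (@meval n K v) (map_mx (@mpolyC n K) M) = M.
Proof. by apply/matrixP => i j; rewrite !mxE /= mevalC. Qed.

(** A chain of k members has dimension k - 1, so the rank r locus with longest
    chain of k_r members contributes m - k_r + r to the geometric rank.  The
    value m - k_1 + 1 is less than m, so k_1 >= 2, and it is at most the value
    m - k_2 + 2, so k_2 <= k_1 + 1, with equality exactly when r = 2 is also
    optimal. *)
Lemma GR_rank1_chains (R : realType) (m : nat) (T : tensor R m m m) :
  degenerate_GR T -> achieves_GR T 1 ->
  exists k : nat,
    [/\ exists X, irreducible_chain (rank_locus T 1) k.+2 X,
        forall k' X, irreducible_chain (rank_locus T 2) k' X -> (k' <= k.+3)%N &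
        (exists X, irreducible_chain (rank_locus T 2) k.+3 X) ->
        achieves_GR T 2].
Proof.
rewrite /degenerate_GR /achieves_GR !minnn => degT GR1.
have [k1 [dim1 [X1 ch1] _]] := proj_dim_chain (rank_locus T 1).
have [k2 [dim2 [X2 ch2] max2]] := proj_dim_chain (rank_locus T 2).
have GR2 : (geometric_rank T <= proj_codim (rank_locus T 2) + 2%:R%:E)%E.
  by apply: ereal_inf_lbound; exists 2%N.
move: GR1 GR2 degT; rewrite /proj_codim dim1 dim2 => ->.
rewrite -!EFinB -!EFinD lee_fin lte_fin => le21 lt1.
have k1_ge2 : (1 < k1)%N by rewrite -(ltr_nat R); lra.
have le_k2 : (k2 <= k1.+1)%N by rewrite -(ler_nat R) -[k1.+1]addn1 natrD; lra.
case: k1 k1_ge2 le_k2 ch1 {dim1 le21 lt1} => [|[|k]] // _ le_k2 ch1.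
exists k; split; [by exists X1 | by move=> k' X /max2 lek';
  apply: leq_trans le_k2 |].
case=> X /max2 ge_k2; have -> : k2 = k.+3 by apply/eqP; rewrite eqn_leq le_k2.
congr (_%:E); rewrite -[k.+3]addn1 natrD; lra.
Qed.

Lemma chain_last_pair (R : realType) (n k : nat) (Y : set 'rV[R[i]]_n) X :
  irreducible_chain Y k.+2 X ->
  exists x y, [/\ X k.+1 x, X k.+1 y & indep2 x y].
Proof.
move=> [irrX ltX]; have [subX nsubX] := ltX k (ltnSn _).
have [[clX [x Xx] _] _] := irrX k (ltnW (ltnSn _)).
have [[clX' _ _] _] := irrX k.+1 (ltnSn _).
have /existsNP[y /not_implyP[X'y nXy]] : ~ forall y, X k.+1 y -> X k y by [].
have nz Y' v : @proj_closed R n Y' -> Y' v -> v != 0 by move=> [S _ ->] [].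
exists x, y; split; [exact: subX | exact: X'y |].
apply: contrapT => /not_indep2_minors /(minors0_proportional (nz _ _ clX Xx)
  (nz _ _ clX' X'y))[t nz_t yE].
by apply: nXy; rewrite yE; apply: (proj_closed_scaling_invariant clX).
Qed.

Lemma segre_line (R : realType) (a b c : nat) (T : tensor R a b c) x y :
  injective (flatA T) -> indep2 x y ->
  (forall s t, (\rank (flatA T (s *: x + t *: y)) <= 1)%N) ->
  exists W : {vspace 'M[R[i]]_(b, c)},
     [/\ (1 < \dim W)%N, [set M | M \in W] `<=` range (flatA T) &
         [set M | M \in W /\ M != 0] `<=` @segre R b c].
Proof.
move=> injT xy rk1; exists <<[:: flatA T x; flatA T y]>>%VS.
have WE M : M \in <<[:: flatA T x; flatA T y]>>%VS ->
    exists s t, M = flatA T (s *: x + t *: y).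
  rewrite span_cons span_seq1 => /memv_addP[_ /vlineP[s ->] [_ /vlineP[t ->]
    ->]].
  by exists s, t; rewrite flatAD !flatAZ.
split.
- rewrite (_ : \dim _ = 2%N) //; apply/eqP; apply: indep2_free => s t.
  by rewrite -!flatAZ -flatAD -(flatA0 T) => /injT /xy.
- by move=> M /WE[s [t ->]]; exists (s *: x + t *: y).
move=> M [/WE[s [t ->]] nz]; apply/eqP; rewrite eqn_leq rk1 /= lt0n mxrank_eq0.
exact: nz.
Qed.

(** The quotient is dual to the inclusion of the span of x1, x12 and x2, which
    are independent because their matrices are. *)
Lemma sym2_quotient (R : realType) (a b c : nat) (T : tensor R a b c)
    (x1 x12 x2 : 'rV_a) (b1 b2 : 'rV_b) (c1 c2 : 'rV_c) :
  indep2 b1 b2 -> indep2 c1 c2 ->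
  flatA T x1 = b1^T *m c1 -> flatA T x12 = b1^T *m c2 + b2^T *m c1 ->
  flatA T x2 = b2^T *m c2 ->
  exists (m' : nat) (Q : 'M[R[i]]_(a, m')),
      (forall w : 'rV[R[i]]_m', exists v : 'rV[R[i]]_a, v *m Q = w) /\
      equiv_sym2 (range (fun beta : 'rV[R[i]]_m' => flatA T (beta *m Q^T))).
Proof.
move=> b12 c12 x1E x12E x2E.
pose Qt : 'M[R[i]]_(3, a) := \matrix_(l < 3) [:: x1; x12; x2]`_l.
have QtE (w : 'rV_3) : flatA T (w *m Qt) =
    w 0 0 *: (b1^T *m c1) + w 0 1 *: (b1^T *m c2 + b2^T *m c1) +
    w 0 2%:R *: (b2^T *m c2).
  rewrite mulmx_sum_row !big_ord_recl big_ord0 addr0 !rowK /= !flatAD !flatAZ.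
  rewrite x1E x12E x2E addrA; congr (_ *: _ + _ *: _ + _ *: _); congr (w 0 _);
    exact/val_inj.
exists 3, Qt^T; rewrite trmxK; split.
  suff /row_fullP[B BQ] : row_full Qt^T by move=> w; exists (w *m B);
    rewrite -mulmxA BQ mulmx1.
  rewrite /row_full mxrank_tr -/(row_free Qt) -kermx_eq0.
  apply/negPn/negP => /rowV0Pn[w /sub_kermxP wQ]; have := QtE w;
    rewrite wQ flatA0.
  set s := w 0 0; set t := w 0 1; set u := w 0 2%:R => stu.
  have [|] := @indep2_outer_eq0 _ _ _ b1 b2 (s *: c1 + t *: c2)
    (t *: c1 + u *: c2) b12.
    rewrite [RHS]stu !mulmxDr -!scalemxAr scalerDr !addrA; congr (_ + _).
  move=> /c12[s0 t0] /c12[_ u0]; case/negP; apply/eqP/rowP =>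
    -[[|[|[|//]]] lt3];
    rewrite mxE; [rewrite -[RHS]s0|rewrite -[RHS]t0|rewrite -[RHS]u0];
      congr (w 0 _); exact/val_inj.
exists b1, b2, c1, c2; split; [exact: indep2_free | exact: indep2_free|].
apply/seteqP; split=> M /=.
  move=> [w _ <-]; rewrite QtE !span_cons span_nil addv0 -addrA.
  by do 2?[apply: memv_add; first by apply/vlineP; eexists]; apply/vlineP;
    eexists.
rewrite !span_cons span_nil addv0.
move=> /memv_addP[_ /vlineP[s ->] [_ /memv_addP[_ /vlineP[t ->] [_ /vlineP[u
  ->] ->]] ->]].
exists (\row_(l < 3) [:: s; t; u]`_l) => //; by rewrite QtE !mxE /= addrA.
Qed.

(** For a point u of the cone S with vertex z, the row space of the matrix of u
    and the row factor c of z together span at most 2 dimensions.  The same then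
    holds at a limit v; there the row space is already the plane <c1, c2>, so
    that c lies in it.  Applied to the transposed flattening, this is the same
    conclusion for column factors. *)
Lemma secant_span (R : realType) (n p q : nat) (S : set 'rV[R[i]]_n)
    (N : 'M[{mpoly R[i][n]}]_(p, q)) (c : 'rV[R[i]]_q) (v : 'rV[R[i]]_n)
    (b1 b2 : 'rV[R[i]]_p) (c1 c2 : 'rV[R[i]]_q) :
  scaling_invariant S -> proj_closure S v ->
  (forall u, S u ->
    (\rank (col_mx (map_mx (meval (fun i => u 0%R i)) N) c) <= 2)%N) ->
  map_mx (meval (fun i => v 0 i)) N = b1^T *m c1 + b2^T *m c2 ->
  indep2 b1 b2 -> indep2 c1 c2 ->
  exists s t, c = s *: c1 + t *: c2.
Proof.
move=> invS clv rkS NvE b12 c12; apply: sub_sum_outer b12 c12 _; rewrite -NvE.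
have colE (u : 'rV_n) :
    map_mx (meval (fun i => u 0 i)) (col_mx N (map_mx (@mpolyC n _) c)) =
    col_mx (map_mx (meval (fun i => u 0 i)) N) c.
  by rewrite map_col_mx map_mx_mpolyC.
rewrite -colE; apply: (@rank_le_closed _ _ _ _ _ S) => [f|u Su].
  exact: proj_closure_vanishes.
by rewrite colE; apply: rkS.
Qed.

Theorem theorem10 (R : realType) (m : nat) (T : tensor R m m m)
    (T_concise : concise T)
    (T_degenerate : degenerate_GR T)
    (rank1_achieves : achieves_GR T 1) :
  (exists W : {vspace 'M[R[i]]_(m, m)},
     [/\ (1 < \dim W)%N,
         [set M | M \in W] `<=` range (flatA T) &
         [set M | M \in W /\ M != 0] `<=` @segre R m m])
  \/
  ((exists (m' : nat) (Q : 'M[R[i]]_(m, m')),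
      (forall w : 'rV[R[i]]_m', exists v : 'rV[R[i]]_m, v *m Q = w) /\
      equiv_sym2 (range (fun beta : 'rV[R[i]]_m' => flatA T (beta *m Q^T))))
   /\ achieves_GR T 2).
Proof.
have [injT _ _] := T_concise.
apply/or_asboolP; rewrite -implyNb; apply/implyP => /asboolPn noline;
  apply/asboolP.
have {T_degenerate rank1_achieves} [k [[X chX] max2 GR2]] :=
  GR_rank1_chains T_degenerate rank1_achieves.
(* a dependence between two factors would put the whole line xy in the Segre
   variety, against noline *)
have indep_factors x y (b1 b2 c1 c2 : 'rV_m) : indep2 x y ->
    flatA T x = b1^T *m c1 -> flatA T y = b2^T *m c2 ->
    indep2 b1 b2 /\ indep2 c1 c2.
  move=> xy xE yE; split; apply: contrapT => dep; apply: noline;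
    apply: segre_line injT xy _ => s t; rewrite flatAD !flatAZ xE yE.
    by rewrite !scalemxAr; apply: rank_sum_outer_le1.
  rewrite -mxrank_tr raddfD /= !linearZ /= !trmx_mul !trmxK !scalemxAr.
  exact: rank_sum_outer_le1.
set Z := X k.+1.
have [x [y [Zx Zy xy]]] := chain_last_pair chX.
have [irrZ ZY] := chX.1 k.+1 (ltnSn _).
have aZ : irreducible Z := proj_irreducible_closed_irreducible irrZ.
have invZ : scaling_invariant Z by case: irrZ => /proj_closed_scaling_invariant.
have factors u : Z u -> exists b c : 'rV_m, flatA T u = b^T *m c.
  by move=> /ZY[_ /rank_le1_outer].
have Z_neq0 u : Z u -> u != 0 by case/ZY.
pose cone u := join_set Z (line_set u).
pose sec := join_set Z Z.
have cone_closed u : Z u -> proj_irreducible_closed (proj_closure (cone u)).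
  move=> Zu; apply: (@proj_closure_irreducible _ _ _ u) (Z_neq0 u Zu).
    by apply: irreducible_sum aZ (irreducible_line u).
  by exists u, 0; split=> //; [exists 0; rewrite ?scale0r | rewrite addr0].
have sec_closed : proj_irreducible_closed (proj_closure sec).
  apply: (@proj_closure_irreducible _ _ _ (x + y)) (indep2_neq0 xy).
    exact: irreducible_sum.
  by exists x, y.
have sec_Y2 : proj_closure sec `<=` rank_locus T 2.
  move=> v clv; split; first by case: clv.
  rewrite -flatA_polyE; apply: (@rank_le_closed _ _ _ _ _ sec) =>
    [f|_ [u [w [Zu Zw ->]]]].
    by apply: proj_closure_vanishes => //; apply: join_scaling_invariant.
  rewrite flatA_polyE flatAD; apply: leq_trans (mxrank_add _ _) _.
  by rewrite -[2%N]/(1 + 1)%N leq_add //; [case: (ZY u Zu) | case: (ZY w Zw)].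
have cone_sec u : Z u -> proj_closure (cone u) `<=` proj_closure sec.
  by move=> Zu; apply/proj_closureS/cone_sub_secant.
(* some w in Z is not proportional to u; were the cone contained in Z, then
   w + u would have rank 1, whereas it has rank 2 *)
have Z_cone u : Z u -> Z `<` proj_closure (cone u).
  move=> Zu; split=> [v Zv|sub].
    apply: sub_proj_closure (Z_neq0 v Zv); exists v, 0.
    by split=> //; [exists 0; rewrite ?scale0r | rewrite addr0].
  have [w [Zw uw]] : exists w, Z w /\ indep2 u w.
    have [ux|nux] := pselect (indep2 u x); first by exists x.
    have [uy|nuy] := pselect (indep2 u y); first by exists y.
    case: (@proportional_indep2N _ _ x 1).
    have [s nz_s xE] := minors0_proportional (Z_neq0 u Zu) (Z_neq0 x Zx)
      (not_indep2_minors nux).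
    have [t nz_t yE] := minors0_proportional (Z_neq0 u Zu) (Z_neq0 y Zy)
      (not_indep2_minors nuy).
    have -> : 1 *: x = (s / t) *: y by rewrite scale1r yE scalerA divfK.
    by rewrite -[x]scale1r; apply: indep2Z; rewrite ?oner_eq0 // mulf_neq0
      ?invr_eq0.
  have : Z (w + u).
    apply: sub; apply: sub_proj_closure (indep2_neq0 (indep2C uw)).
    by exists w, u; split=> //; exists 1; rewrite ?scale1r.
  case/ZY=> _; apply/negP; rewrite -ltnNge flatAD.
  have [[b1 [c1 wE]] [b2 [c2 uE]]] := (factors w Zw, factors u Zu).
  have [b12 c12] := indep_factors _ _ _ _ _ _ (indep2C uw) wE uE.
  rewrite wE uE sum_outer mxrankMfree; last exact/indep2P.
  by rewrite mxrank_tr; move/indep2P/eqP: b12 => ->.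
have chain_cone u (Zu : Z u) := irreducible_chain_rcons chX
  (fun v Yv => conj Yv.1 (leqW Yv.2) : rank_locus T 2 v) (cone_closed u Zu)
  (subset_trans (cone_sec u Zu) sec_Y2) (Z_cone u Zu).
split; last by apply: GR2; eexists; apply: chain_cone Zx.
(* otherwise the chain extended by the cone could be extended once more by the
   secant closure, beyond the length allowed in the rank 2 locus *)
have sec_cone u : Z u -> proj_closure sec `<=` proj_closure (cone u).
  move=> Zu; apply: contrapT => nsub.
  have := irreducible_chain_rcons (chain_cone u Zu)
    (@subset_refl _ _) sec_closed sec_Y2.
  rewrite ltnn => /(_ (conj (cone_sec u Zu) nsub)) /max2; by rewrite ltnn.
have [z [Zz xz yz]] := third_point aZ Zx Zy xy.
have [b1 [c1 xE]] := factors x Zx.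
have [b2 [c2 yE]] := factors y Zy.
have [b3 [c3 zE]] := factors z Zz.
have [b12 c12] := indep_factors _ _ _ _ _ _ xy xE yE.
have [b13 c13] := indep_factors _ _ _ _ _ _ xz xE zE.
have [b23 c23] := indep_factors _ _ _ _ _ _ yz yE zE.
have inv_cone : scaling_invariant (cone z).
  by apply: join_scaling_invariant => //; apply: line_scaling_invariant.
have xy_cone : proj_closure (cone z) (x + y).
  by apply: sec_cone => //; apply: sub_proj_closure (indep2_neq0 xy);
    exists x, y.
have [s1 [s2 c3E]] : exists s1 s2, c3 = s1 *: c1 + s2 *: c2.
  apply: (secant_span (N := flatA_poly T)) inv_cone xy_cone _ _ b12 c12;
    last first.
    by rewrite flatA_polyE flatAD xE yE.
  move=> _ [u [_ [Zu [t _ <-] ->]]]; rewrite flatA_polyE flatAD flatAZ zE.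
  by have [b [c ->]] := factors u Zu; apply: rank_cone_le2.
have [t1 [t2 b3E]] : exists t1 t2, b3 = t1 *: b1 + t2 *: b2.
  apply: (secant_span (N := (flatA_poly T)^T)) inv_cone xy_cone _ _ c12 b12;
    last first.
    by rewrite -map_trmx flatA_polyE flatAD xE yE raddfD /= !trmx_mul !trmxK.
  move=> _ [u [_ [Zu [t _ <-] ->]]]; rewrite -map_trmx flatA_polyE flatAD
    flatAZ zE.
  have [b [c ->]] := factors u Zu; rewrite raddfD /= linearZ /= !trmx_mul
    !trmxK.
  exact: rank_cone_le2.
have nz_s2 : s2 != 0 by apply: (@indep2_coef_neq0 _ _ c1 c2 s1); rewrite -c3E.
have nz_s1 : s1 != 0 by apply: (@indep2_coef_neq0 _ _ c2 c1 s2);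
  rewrite addrC -c3E.
have nz_t2 : t2 != 0 by apply: (@indep2_coef_neq0 _ _ b1 b2 t1); rewrite -b3E.
have nz_t1 : t1 != 0 by apply: (@indep2_coef_neq0 _ _ b2 b1 t2);
  rewrite addrC -b3E.
have trZ s (b : 'rV[R[i]]_m) : (s *: b)^T = s *: b^T by rewrite linearZ.
(* with the factors rescaled to t1 b1, t2 b2, s1 c1, s2 c2, the matrix of z is
   the tensor product of the sums, so removing its two diagonal terms leaves
   the off-diagonal symmetric matrix *)
apply: (@sym2_quotient _ _ _ _ T ((s1 * t1) *: x)
  (z - (s1 * t1) *: x - (s2 * t2) *: y) ((s2 * t2) *: y)
  (t1 *: b1) (t2 *: b2) (s1 *: c1) (s2 *: c2)); try exact: indep2Z.
- by rewrite flatAZ xE trZ -scalemxAl -scalemxAr scalerA mulrC.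
- rewrite -[- (_ *: x)]scaleNr -[- (_ *: y)]scaleNr !flatAD !flatAZ xE yE zE
  b3E c3E.
  by apply/matrixP => l j; rewrite !mxE !big_ord1 !mxE; ring.
- by rewrite flatAZ yE trZ -scalemxAl -scalemxAr scalerA mulrC.
Qed.
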